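(* Let $\hat W$ be a large complex structure flux superpotential, not identically zero, $$\hat W=w\left[n_0'-m^0\tilde c+i\,n_a'Z^a-\tfrac12\tilde d_{abc}m^aZ^bZ^c+\tfrac{i\,m^0}{6}\tilde d_{abc}Z^aZ^bZ^c\right],$$ and let $\hat K=-\log\left(\tfrac43\tilde\kappa+k\right)$ be the large complex structure Kähler potential. Suppose that at a point $Z^a=z^a+i\chi^a$ the F-term equations $$F_a=\frac{\partial\hat W}{\partial Z^a}+\frac{\partial\hat K}{\partial Z^a}\hat W=0\qquad\text{for all }a=1,\dots,h^{2,1}(X)$$ hold, and let $W_0=\hat W$ and $U_0=e^{\hat K/2}\hat W$, with $\tilde\kappa=\tilde d_{abc}z^az^bz^c$, all evaluated at this solution. Then: (i) if $m^0\neq 0$, $$|\mathrm{Im}(W_0)|=\frac{2|w|}{3}\left(1+\frac{3k}{4\tilde\kappa}\right)|m^0|\,\tilde\kappa,\qquad |\mathrm{Im}(U_0)|=|w|\sqrt{\frac13\left(1+\frac{3k}{4\tilde\kappa}\right)}\;|m^0|\,\tilde\kappa^{1/2};$$ (ii) if $m^0=0$, $$|\mathrm{Re}(W_0)|=\frac{2|w|}{3}\left(1+\frac{3k}{4\tilde\kappa}\right)|\tilde\kappa(m)|^{1/3}\,\tilde\kappa^{2/3},\qquad |\mathrm{Re}(U_0)|=|w|\sqrt{\frac13\left(1+\frac{3k}{4\tilde\kappa}\right)}\;|\tilde\kappa(m)|^{1/3}\,\tilde\kappa^{1/6},$$ where $\tilde\kappa(m):=\tilde d_{abc}m^am^bm^c$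 is a non-zero integer.
   Context: Let $X$ be a Calabi–Yau three-fold with mirror $\tilde X$. Indices $a,b,c$ run over $1,\dots,h^{2,1}(X)$, the index $A$ over $0,\dots,h^{2,1}(X)$, and repeated indices are summed. The complex structure moduli space of $X$ has homogeneous coordinates $\mathcal{Z}^A$ and, for $\mathcal{Z}^0\ne0$, affine coordinates $\mathcal{Z}^a/\mathcal{Z}^0$. With a prepotential $\mathcal{F}$ and $\mathcal{F}_A=\partial\mathcal{F}/\partial\mathcal{Z}^A$, the heterotic flux superpotential is $W=w(n_A\mathcal{Z}^A-m^A\mathcal{F}_A)$ with flux integers $n_A,m^A\in\mathbb{Z}$ and a non-zero real constant $w$. The complex structure Kähler potential is $K=-\log[i(\bar{\mathcal{Z}}^A\mathcal{F}_A-\mathcal{Z}^A\bar{\mathcal{F}}_A)]$. Their affine versions are $\hat W=W/\mathcal{Z}^0$ and $\hat K=K+\log|\mathcal{Z}^0|^2$. In the large complex structure limit (exponential terms neglected) the prepotential is $$\mathcal{F}=-\frac16\frac{\tilde d_{abc}\mathcal{Z}^a\mathcal{Z}^b\mathcal{Z}^c}{\mathcal{Z}^0}+\frac12\tilde a_{ab}\mathcal{Z}^a\mathcal{Z}^b+\tilde b_a\mathcal{Z}^a\mathcal{Z}^0+\frac12\tilde c(\mathcal{Z}^0)^2 .$$ Here $\tilde d_{abc}$ are the triple intersection numbers of $\tilde X$ (integers, totally symmetric in the indices); $\tilde a_{ab}=\tilde d_{aab}$ for $a\ge b$ and $\tilde a_{ab}=\tilde d_{abb}$ for $a<b$ (no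 summation); $\tilde b_a=\frac1{24}c_{2,a}(\tilde X)$, where $c_2(\tilde X)$ is the second Chern class (so $\tilde b_a$ is real); and $\tilde c=-\frac{i\,\zeta(3)}{(2\pi)^3}\eta(\tilde X)$ with $\eta(\tilde X)$ the Euler number of $\tilde X$ (so $\tilde c$ is purely imaginary). Denote by $Z^a$ the affine coordinates after the redefinition $Z^a\mapsto iZ^a$ (i.e. $\mathcal{Z}^a/\mathcal{Z}^0=iZ^a$), and write $Z^a=z^a+i\chi^a$ with $z^a,\chi^a$ real. Then $\hat W$ and $\hat K$ take the forms displayed in the claim, with $$n_0'=n_0-m^a\tilde b_a,\qquad n_a'=n_a-m^0\tilde b_a-m^b\tilde a_{ba},\qquad \tilde\kappa=\tilde d_{abc}z^az^bz^c,\qquad k=i(\tilde c-\tilde c^* )\in\mathbb{R}.$$ Derivatives $\partial/\partial Z^a$ are holomorphic (Wirtinger) derivatives. Standing assumptions at the points considered (large complex structure regime): $\tilde\kappa>0$; $\hat K$ is well defined, i.e. $\tilde\kappa>-3k/4$; and the Kähler metric $\partial^2\hat K/\partial Z^a\partial\bar Z^b$ is non-degenerate. *)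

(* Defs.v *)
From HB Require Import structures.
From mathcomp Require Import all_boot all_order all_algebra.
From mathcomp Require Import all_classical all_reals all_analysis.
From mathcomp Require Export complex.
From mathcomp Require Import ring.

Set Implicit Arguments.
Unset Strict Implicit.
Unset Printing Implicit Defensive.

Import Order.TTheory GRing.Theory Num.Theory.
Import numFieldNormedType.Exports.
Local Open Scope ring_scope.
Local Open Scope complex_scope.

(* Derivative at t = 0, t real, of t |-> f (Z + t v). It is taken separately
   on the real and imaginary parts because the library's [derive1] is used
   over the real field R. *)
Definition real_derive (R : realType) (h : nat) (f : 'rV[R[i]]_h -> R[i])
    (v Z : 'rV[R[i]]_h) : R[i] :=
  derive1 (fun t : R => complex.Re (f (Z + t%:C *: v))) 0
  +i* derive1 (fun t : R => complex.Im (f (Z + t%:C *: v))) 0.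

(* Wirtinger derivatives: with Z^a = z^a + i chi^a,
   d/dZ^a = (d/dz^a - i d/dchi^a) / 2, d/dZbar^a = (d/dz^a + i d/dchi^a) / 2. *)
Definition wirtinger (R : realType) (h : nat) (a : 'I_h)
    (f : 'rV[R[i]]_h -> R[i]) (Z : 'rV[R[i]]_h) : R[i] :=
  (real_derive f (delta_mx 0 a) Z
   - 'i * real_derive f ('i *: delta_mx 0 a) Z) / 2.

Definition wirtinger_bar (R : realType) (h : nat) (a : 'I_h)
    (f : 'rV[R[i]]_h -> R[i]) (Z : 'rV[R[i]]_h) : R[i] :=
  (real_derive f (delta_mx 0 a) Z
   + 'i * real_derive f ('i *: delta_mx 0 a) Z) / 2.

Definition zeta3 (R : realType) : R := limn (series (riemannR (3 : R))).

(* Topological data of the mirror three-fold that enter the large complex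
   structure prepotential; h stands for h^{2,1}(X) = h^{1,1}(mirror). *)
Record mirror_data (R : realType) (h : nat) := MirrorData {
  triple : 'I_h -> 'I_h -> 'I_h -> int;
  triple_swap12 : forall a b c, triple a b c = triple b a c;
  triple_swap23 : forall a b c, triple a b c = triple a c b;
  chern2 : 'I_h -> R;
  euler : int }.

(* d_abc x^a y^b u^c, in any ring *)
Definition trilin (R : realType) (h : nat) (D : mirror_data R h)
    (S : pzRingType) (x y u : 'I_h -> S) : S :=
  \sum_(a < h) \sum_(b < h) \sum_(c < h)
    (triple D a b c)%:~R * x a * y b * u c.

Definition a_tilde (R : realType) (h : nat) (D : mirror_data R h)
    (a b : 'I_h) : int :=
  if (b <= a)%N then triple D a a b else triple D a b b.

Definition b_tilde (R : realType) (h : nat) (D : mirror_data R h)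
    (a : 'I_h) : R := chern2 D a / 24.

Definition c_tilde (R : realType) (h : nat) (D : mirror_data R h) : R[i] :=
  - ('i * (zeta3 R)%:C / ((2 * pi) ^+ 3)%:C) * (euler D)%:~R.

Definition k_const (R : realType) (h : nat) (D : mirror_data R h) : R :=
  complex.Re ('i * (c_tilde D - (c_tilde D)^*)).

Lemma k_constE (R : realType) (h : nat) (D : mirror_data R h) :
  (k_const D)%:C = 'i * (c_tilde D - (c_tilde D)^*).
Proof.
rewrite /k_const; case: (c_tilde D) => x y.
by apply/eqP; rewrite eq_complex /=; apply/andP; split=> //; apply/eqP; ring.
Qed.

(* Flux vectors n_A, m^A are indexed by 'I_h.+1: A = 0 is [ord0] and
   A = a is [lift ord0 a]. *)
Definition flux_tail (h : nat) (n : 'I_h.+1 -> int) (a : 'I_h) : int :=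
  n (lift ord0 a).

Definition n0_prime (R : realType) (h : nat) (D : mirror_data R h)
    (n m : 'I_h.+1 -> int) : R :=
  (n ord0)%:~R - \sum_(a < h) (flux_tail m a)%:~R * b_tilde D a.

Definition n_prime (R : realType) (h : nat) (D : mirror_data R h)
    (n m : 'I_h.+1 -> int) (a : 'I_h) : R :=
  (flux_tail n a)%:~R - (m ord0)%:~R * b_tilde D a
  - \sum_(b < h) (flux_tail m b * a_tilde D b a)%:~R.

Definition W_hat (R : realType) (h : nat) (D : mirror_data R h) (w : R)
    (n m : 'I_h.+1 -> int) (Z : 'rV[R[i]]_h) : R[i] :=
  w%:C * ((n0_prime D n m)%:C - (m ord0)%:~R * c_tilde D
          + 'i * \sum_(a < h) (n_prime D n m a)%:C * Z 0 a
          - 2^-1 * trilin D (fun a => (flux_tail m a)%:~R) (Z 0) (Z 0)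
          + 'i * (m ord0)%:~R / 6 * trilin D (Z 0) (Z 0) (Z 0)).

Definition kappa (R : realType) (h : nat) (D : mirror_data R h)
    (Z : 'rV[R[i]]_h) : R :=
  let z a := complex.Re (Z 0 a) in trilin D z z z.

Definition kappa_flux (R : realType) (h : nat) (D : mirror_data R h)
    (m : 'I_h.+1 -> int) : int :=
  trilin D (flux_tail m) (flux_tail m) (flux_tail m).

Definition K_hat (R : realType) (h : nat) (D : mirror_data R h)
    (Z : 'rV[R[i]]_h) : R :=
  - ln (4 / 3 * kappa D Z + k_const D).

Definition K_hatC (R : realType) (h : nat) (D : mirror_data R h)
    (Z : 'rV[R[i]]_h) : R[i] := (K_hat D Z)%:C.

Definition kahler_metric (R : realType) (h : nat) (D : mirror_data R h)
    (Z : 'rV[R[i]]_h) : 'M[R[i]]_h :=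
  \matrix_(a < h, b < h) wirtinger a (wirtinger_bar b (K_hatC D)) Z.

Definition F_term (R : realType) (h : nat) (D : mirror_data R h) (w : R)
    (n m : 'I_h.+1 -> int) (a : 'I_h) (Z : 'rV[R[i]]_h) : R[i] :=
  wirtinger a (W_hat D w n m) Z
  + wirtinger a (K_hatC D) Z * W_hat D w n m Z.

Definition U_hat (R : realType) (h : nat) (D : mirror_data R h) (w : R)
    (n m : 'I_h.+1 -> int) (Z : 'rV[R[i]]_h) : R[i] :=
  (expR (K_hat D Z / 2))%:C * W_hat D w n m Z.

(* Main.v *)
(* With G = 4/3 kappa + k, so that K = - log G, the real part z of Z satisfies
   z^a K_{a bbar} = 2 (2/3 kappa - k) kappa_b / G^2 with kappa_b = d_bcd z^c z^d;
   hence non-degeneracy of the metric forces k <> 2/3 kappa. Contracting Im F_a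
   with z^a eliminates the fluxes n'_a and gives
   (2/3 kappa - k) (Im W - w m^0 G / 2) = 0, which is (i) since
   G / 2 = 2/3 kappa (1 + 3 k / (4 kappa)). If m^0 = 0, then Re F_a = 0 reads
   d_abc z^b (m^c - lambda z^c) = 0 with lambda = - 2 Re W / (w G). A vector
   annihilated by d_abc z^b is null for the metric, so m = lambda z and
   kappa(m) = lambda^3 kappa, which is (ii). If lambda were zero, then W would
   vanish at Z and F_a = 0 would kill every remaining flux. *)
Require Import Defs.
From mathcomp Require Import all_boot all_order all_algebra.
From mathcomp Require Import all_classical all_reals all_analysis.
From mathcomp Require Import ring lra.

Set Implicit Arguments.
Unset Strict Implicit.
Unset Printing Implicit Defensive.

Import Order.TTheory GRing.Theory Num.Theory.
Import numFieldNormedType.Exports.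
Local Open Scope ring_scope.

(** * Algebra of the symmetric trilinear form d_abc *)

Section Trilinear.
Context {R : realType} {h : nat} (D : mirror_data R h).

Lemma trilinC12 (S : comPzRingType) (x y u : 'I_h -> S) :
  trilin D x y u = trilin D y x u.
Proof.
rewrite /trilin exchange_big; apply: eq_bigr => b _; apply: eq_bigr => a _.
by apply: eq_bigr => c _; rewrite triple_swap12 (mulrAC _ (x a)).
Qed.

Lemma trilinC23 (S : comPzRingType) (x y u : 'I_h -> S) :
  trilin D x y u = trilin D x u y.
Proof.
rewrite /trilin; apply: eq_bigr => a _; rewrite exchange_big.
by apply: eq_bigr => c _; apply: eq_bigr => b _; rewrite triple_swap23 mulrAC.
Qed.

(** The shape x + k x' covers shifts Z + t v along a line, splittings Re + i Im and the combination
    m - lambda z, so rewriting with the three slot versions expands all of them. *)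
Lemma trilinPl (S : comPzRingType) (k : S) (x x' y u : 'I_h -> S) :
  trilin D (fun a => x a + k * x' a) y u
  = trilin D x y u + k * trilin D x' y u.
Proof.
rewrite /trilin mulr_sumr -big_split; apply: eq_bigr => a _ /=.
rewrite mulr_sumr -big_split; apply: eq_bigr => b _ /=.
rewrite mulr_sumr -big_split; apply: eq_bigr => c _ /=.
by rewrite mulrDr !mulrDl -!mulrA (mulrCA _ k).
Qed.

Lemma trilinPm (S : comPzRingType) (k : S) (x y y' u : 'I_h -> S) :
  trilin D x (fun a => y a + k * y' a) u
  = trilin D x y u + k * trilin D x y' u.
Proof. by rewrite trilinC12 trilinPl !(trilinC12 x). Qed.

Lemma trilinPr (S : comPzRingType) (k : S) (x y u u' : 'I_h -> S) :
  trilin D x y (fun a => u a + k * u' a)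
  = trilin D x y u + k * trilin D x y u'.
Proof. by rewrite trilinC23 trilinPm !(trilinC23 x y). Qed.

Lemma trilinZl (S : comPzRingType) (k : S) (x y u : 'I_h -> S) :
  trilin D (fun a => k * x a) y u = k * trilin D x y u.
Proof.
rewrite /trilin mulr_sumr; apply: eq_bigr => a _.
rewrite mulr_sumr; apply: eq_bigr => b _; rewrite mulr_sumr.
by apply: eq_bigr => c _; rewrite (mulrCA _ k) !mulrA.
Qed.

Lemma trilinZr (S : comPzRingType) (k : S) (x y u : 'I_h -> S) :
  trilin D x y (fun a => k * u a) = k * trilin D x y u.
Proof. by rewrite trilinC23 trilinC12 trilinZl trilinC12 trilinC23. Qed.

(** Placing this basis vector in a slot leaves that index free: [trilin D x y (unitf a)] is d_bca
    x^b y^c. *)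
Definition unitf {S : pzRingType} (a : 'I_h) : 'I_h -> S :=
  fun b => (b == a)%:R.

Lemma trilin0l (S : pzRingType) (y u : 'I_h -> S) :
  trilin D (fun=> 0) y u = 0.
Proof.
rewrite /trilin big1 // => a _; rewrite big1 // => b _; rewrite big1 // => c _.
by rewrite mulr0 !mul0r.
Qed.

(** By symmetry the last slot moves to the front, where its sum is outermost and the basis vector
    selects a single term. This is how equations with a free index are contracted with a vector. *)
Lemma trilin_unitf (S : comPzRingType) (x y u : 'I_h -> S) :
  trilin D x y u = \sum_a u a * trilin D x y (unitf a).
Proof.
under [RHS]eq_bigr => c _ do rewrite trilinC23 trilinC12.
rewrite trilinC23 trilinC12 {1}/trilin; apply: eq_bigr => c _.
rewrite [in RHS]/trilin [X in _ * X](bigD1 c) //= [X in _ + X]big1 => [|c' neq].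
  rewrite addr0 mulr_sumr; apply: eq_bigr => a _; rewrite mulr_sumr.
  by apply: eq_bigr => b _; rewrite /unitf eqxx mulr1 !mulrA (mulrC (u c)).
rewrite big1 // => a _; rewrite big1 // => b _.
by rewrite /unitf (negPf neq) mulr0 !mul0r.
Qed.

Lemma rmorph_trilin (S S' : pzRingType) (f : {rmorphism S -> S'})
    (x y u : 'I_h -> S) :
  f (trilin D x y u) = trilin D (f \o x) (f \o y) (f \o u).
Proof.
rewrite /trilin rmorph_sum; apply: eq_bigr => a _.
rewrite rmorph_sum; apply: eq_bigr => b _; rewrite rmorph_sum.
by apply: eq_bigr => c _; rewrite !rmorphM rmorph_int.
Qed.

(** Each argument splits as Re + i Im; multilinearity gives eight terms, each the image of a real
    form under the embedding of R. *)
Lemma trilin_complex (x y u : 'I_h -> R[i]) :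
  let T := @trilin R h D R in
  let xr := fun a => complex.Re (x a) in let xi := fun a => complex.Im (x a) in
  let yr := fun a => complex.Re (y a) in let yi := fun a => complex.Im (y a) in
  let ur := fun a => complex.Re (u a) in let ui := fun a => complex.Im (u a) in
  trilin D x y u =
  Complex (T xr yr ur - T xr yi ui - T xi yr ui - T xi yi ur)
          (T xr yr ui + T xr yi ur + T xi yr ur - T xi yi ui).
Proof.
move=> T xr xi yr yi ur ui.
pose cr : {rmorphism R -> R[i]} := real_complex R.
have split (v : 'I_h -> R[i]) :
    v = fun a => (cr \o ((fun a => complex.Re (v a)))) a
                 + Complex 0 1 * (cr \o ((fun a => complex.Im (v a)))) a.
  by apply: funext => a; rewrite /= [LHS]complexE.
rewrite {1}(split x) {1}(split y) {1}(split u).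
rewrite !(trilinPl, trilinPm, trilinPr) -!rmorph_trilin /=.
rewrite -/T -/xr -/xi -/yr -/yi -/ur -/ui.
by apply/eqP; rewrite eq_complex /=; apply/andP; split; apply/eqP; ring.
Qed.

Lemma trilin_realc (x : 'I_h -> R) (y u : 'I_h -> R[i]) :
  let T := @trilin R h D R in
  let yr := fun a => complex.Re (y a) in let yi := fun a => complex.Im (y a) in
  let ur := fun a => complex.Re (u a) in let ui := fun a => complex.Im (u a) in
  trilin D (fun a => real_complex R (x a)) y u =
  Complex (T x yr ur - T x yi ui) (T x yr ui + T x yi ur).
Proof.
by move=> T yr yi ur ui; rewrite trilin_complex /= !trilin0l !(subr0, addr0).
Qed.

End Trilinear.

(** * Derivatives along real lines and Wirtinger derivatives *)

Lemma is_derive_cubic {R : realType} (r0 r1 r2 r3 : R) :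
  is_derive (0 : R) 1 (fun t => r0 + r1 * t + r2 * t ^+ 2 + r3 * t ^+ 3) r1.
Proof.
apply: is_derive_eq; rewrite /GRing.scale /=; ring.
Qed.

Section Wirtinger.
Context {R : realType} {h : nat}.
Implicit Types (f : 'rV[R[i]]_h -> R[i]) (v Z : 'rV[R[i]]_h).
Local Open Scope complex_scope.

Lemma derive1_cubic (r0 r1 r2 r3 : R) :
  derive1 (fun t => r0 + r1 * t + r2 * t ^+ 2 + r3 * t ^+ 3) 0 = r1.
Proof. by rewrite derive1E; have [_] := is_derive_cubic r0 r1 r2 r3. Qed.

(** The superpotential restricted to a real line is a cubic polynomial in t, so its derivative can
    be read off as the linear coefficient, without product rules over the complex numbers. *)
Lemma real_derive_cubic f v Z (c1 c2 c3 : R[i]) :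
  (forall t : R, f (Z + t%:C *: v)
     = f Z + c1 * t%:C + c2 * t%:C ^+ 2 + c3 * t%:C ^+ 3) ->
  real_derive f v Z = c1.
Proof.
move=> fE; rewrite /real_derive.
under eq_fun do rewrite fE -!rmorphXn /=.
under [X in _ +i* derive1 X _]eq_fun do rewrite fE -!rmorphXn /=.
move: (f Z) c1 c2 c3 {fE} => [x0 y0] [x1 y1] [x2 y2] [x3 y3]; congr Complex.
  apply: etrans (derive1_cubic x0 x1 x2 x3); congr (derive1 _ 0).
  by apply: funext => t /=; ring.
apply: etrans (derive1_cubic y0 y1 y2 y3); congr (derive1 _ 0).
by apply: funext => t /=; ring.
Qed.

Definition re_row Z : 'rV[R]_h := \row_b complex.Re (Z 0 b).

Lemma re_row_shift Z (a : 'I_h) (t : R) :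
  re_row (Z + t%:C *: delta_mx 0 a) = re_row Z + t *: delta_mx 0 a.
Proof.
apply/rowP => b; rewrite !mxE /=.
by case: (Z 0 b) => x y; case: (b == a); rewrite /= ?mul0r ?subr0.
Qed.

Lemma re_row_ishift Z (a : 'I_h) (t : R) :
  re_row (Z + t%:C *: ('i *: delta_mx 0 a)) = re_row Z.
Proof.
apply/rowP => b; rewrite !mxE -complexiE /=.
by case: (Z 0 b) => x y; case: (b == a) => /=; ring.
Qed.

(** A function of the real parts is constant along i e_a, so both Wirtinger derivatives reduce to
    half the real partial derivative. *)
Lemma wirtinger_re_row (phi : 'rV[R]_h -> R) (a : 'I_h) Z :
  let dphi := derive1 (fun t => phi (re_row Z + t *: delta_mx 0 a)) 0 in
  wirtinger a (fun Y => (phi (re_row Y))%:C) Z = (dphi / 2)%:C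
  /\ wirtinger_bar a (fun Y => (phi (re_row Y))%:C) Z = (dphi / 2)%:C.
Proof.
move=> dphi; pose f Y := (phi (re_row Y))%:C.
have d1 : real_derive f (delta_mx 0 a) Z = dphi%:C.
  rewrite /real_derive /f /=; congr Complex; last by rewrite derive1_cst.
  by congr (derive1 _ 0); apply: funext => t; rewrite re_row_shift.
have d2 : real_derive f ('i *: delta_mx 0 a) Z = 0.
  rewrite /real_derive /f /=; congr Complex; last by rewrite derive1_cst.
  rewrite -[RHS](derive1_cst (phi (re_row Z)) 0).
  by congr (derive1 _ 0); apply: funext => t; rewrite re_row_ishift.
rewrite /wirtinger /wirtinger_bar -/f d1 d2 mulr0 subr0 addr0.
by rewrite rmorphM fmorphV rmorph_nat.
Qed.

End Wirtinger.

(** * Derivatives of the superpotential and of the Kähler potential *)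

Section Potentials.
Context {R : realType} {h : nat} (D : mirror_data R h).
Local Open Scope complex_scope.

Lemma row_shift (S : comPzRingType) (Z v : 'rV[S]_h) (t : S) :
  (Z + t *: v) 0 = fun a => Z 0 a + t * v 0 a.
Proof. by apply: funext => a; rewrite !mxE. Qed.

Lemma delta_unitf (S : pzRingType) (a : 'I_h) :
  (delta_mx 0 a : 'rV[S]_h) 0 = unitf a.
Proof. by apply: funext => b; rewrite mxE eqxx. Qed.

Section Superpotential.
Context (w : R) (n m : 'I_h.+1 -> int).
Local Notation T := (@trilin R h D R[i]).
Local Notation mv := (fun a => (flux_tail m a)%:~R).

Definition dW_hat (Z v : 'rV[R[i]]_h) : R[i] :=
  w%:C * ('i * \sum_a (n_prime D n m a)%:C * v 0 a
          - trilin D mv (Z 0) (v 0)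
          + 'i * (m ord0)%:~R / 2 * trilin D (Z 0) (Z 0) (v 0)).

Lemma real_derive_W_hat v Z : real_derive (W_hat D w n m) v Z = dW_hat Z v.
Proof.
(* The two explicit arguments are the coefficients of t^2 and t^3 in W(Z + t v). *)
apply: (@real_derive_cubic _ _ _ _ _ _
  (w%:C * (- 2^-1 * T mv (v 0) (v 0)
     + 'i * (m ord0)%:~R / 2 * T (Z 0) (v 0) (v 0)))
  (w%:C * ('i * (m ord0)%:~R / 6 * T (v 0) (v 0) (v 0)))) => t.
rewrite /W_hat /dW_hat row_shift !(trilinPl, trilinPm, trilinPr).
under eq_bigr do rewrite mulrDr mulrCA.
rewrite big_split /= -mulr_sumr.
(* Permuted mixed terms are brought to one normal form, so that [field] treats them as the same
   atom. *)
have e1 : T (v 0) (Z 0) (Z 0) = T (Z 0) (Z 0) (v 0).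
  by rewrite trilinC12 trilinC23.
have e2 : T (Z 0) (v 0) (Z 0) = T (Z 0) (Z 0) (v 0) by exact: trilinC23.
have e3 : T (v 0) (Z 0) (v 0) = T (Z 0) (v 0) (v 0) by exact: trilinC12.
have e4 : T (v 0) (v 0) (Z 0) = T (Z 0) (v 0) (v 0).
  by rewrite trilinC23 trilinC12.
have e5 : T mv (v 0) (Z 0) = T mv (Z 0) (v 0) by exact: trilinC23.
rewrite e1 e2 e3 e4 e5.
by field.
Qed.

(** W is holomorphic: [dW_hat] is complex linear in the direction, so the derivative along i e_a is
    i times the one along e_a, and the Wirtinger average returns the latter. *)
Lemma wirtinger_W_hat a Z :
  wirtinger a (W_hat D w n m) Z
  = w%:C * ('i * (n_prime D n m a)%:C - trilin D mv (Z 0) (unitf a)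
            + 'i * (m ord0)%:~R / 2 * trilin D (Z 0) (Z 0) (unitf a)).
Proof.
have dWZ (c : R[i]) (v : 'rV[R[i]]_h) : dW_hat Z (c *: v) = c * dW_hat Z v.
  have cvE : (c *: v) 0 = fun b => c * v 0 b.
    by apply: funext => b; rewrite mxE.
  rewrite /dW_hat cvE !trilinZr.
  under eq_bigr do rewrite mulrCA.
  by rewrite -mulr_sumr; ring.
rewrite /wirtinger !real_derive_W_hat dWZ mulrA -expr2 sqrCi mulN1r opprK.
have halfK (x : R[i]) : (x + x) / 2 = x by field.
rewrite halfK /dW_hat delta_unitf.
congr (_ * (_ * _ - _ + _)).
rewrite (bigD1 a) //= big1 => [|b neq_ba]; last first.
  by rewrite /unitf (negPf neq_ba) mulr0.
by rewrite /unitf eqxx mulr1 addr0.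
Qed.
End Superpotential.

Section Kahler.
Implicit Type x : 'rV[R]_h.
Local Notation T := (@trilin R h D R).

(** This is the G of the overview, equal to exp(-K) where positive, as a function of the real parts
    alone. *)
Definition volume x : R := 4 / 3 * T (x 0) (x 0) (x 0) + k_const D.
Local Notation G := volume.
Local Notation phi := (fun x => - ln (G x)).
Local Notation dphi a x := (derive1 (fun t => phi (x + t *: delta_mx 0 a)) 0).

Lemma is_derive_volume x a :
  is_derive (0 : R) 1 (fun t => G (x + t *: delta_mx 0 a))
    (4 * T (x 0) (x 0) (unitf a)).
Proof.
pose r2 := 4 * T (x 0) (unitf a) (unitf a).
pose r3 := 4 / 3 * T (unitf a) (unitf a) (unitf a).
rewrite (_ : (fun t => _) = fun t => G x + 4 * T (x 0) (x 0) (unitf a) * t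
                         + r2 * t ^+ 2 + r3 * t ^+ 3).
  exact: is_derive_cubic.
apply: funext => t; rewrite /volume row_shift delta_unitf.
rewrite !(trilinPl, trilinPm, trilinPr).
have e1 : T (unitf a) (x 0) (x 0) = T (x 0) (x 0) (unitf a).
  by rewrite trilinC12 trilinC23.
have e2 : T (x 0) (unitf a) (x 0) = T (x 0) (x 0) (unitf a) by exact: trilinC23.
have e3 : T (unitf a) (x 0) (unitf a) = T (x 0) (unitf a) (unitf a).
  by exact: trilinC12.
have e4 : T (unitf a) (unitf a) (x 0) = T (x 0) (unitf a) (unitf a).
  by rewrite trilinC23 trilinC12.
by rewrite e1 e2 e3 e4 /r2 /r3; field.
Qed.

Lemma derive1_phi x a : 0 < G x ->
  dphi a x = - (4 * T (x 0) (x 0) (unitf a) / G x).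
Proof.
move=> G_gt0; rewrite derive1E.
have Gd := is_derive_volume x a.
have x0 : x + 0 *: delta_mx 0 a = x by rewrite scale0r addr0.
have lnd : is_derive (G (x + 0 *: delta_mx 0 a)) 1 (@ln R) (G x)^-1.
  by rewrite x0; exact: is_derive1_ln.
have [_ dE] := is_deriveN (is_derive1_comp
  (g := fun t => G (x + t *: delta_mx 0 a)) (x := 0) lnd Gd).
by rewrite [LHS]dE mulrC.
Qed.

(** The closed form of the first derivative of - ln G needs G > 0; differentiating it again requires
    this on a neighbourhood. *)
Lemma volume_gt0_near x a :
  0 < G x -> \forall t \near (0 : R), 0 < G (x + t *: delta_mx 0 a).
Proof.
move=> G_gt0; have [Gd _] := is_derive_volume x a.
have /differentiable_continuous cG := (derivable1_diffP _ _).1 Gd.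
apply: (cvgr_gt _ cG).
by rewrite scale0r addr0.
Qed.

Lemma derive1_dphi x a b : 0 < G x ->
  derive1 (fun t => dphi b (x + t *: delta_mx 0 a) / 2) 0
  = 2 * (- 2 * T (x 0) (unitf a) (unitf b) / G x
     + 4 * T (x 0) (x 0) (unitf a) * T (x 0) (x 0) (unitf b) / G x ^+ 2).
Proof.
move=> G_gt0; rewrite derive1E.
(* Half the first derivative in closed form; it agrees with the differentiated function only near t
   = 0, which suffices for the derivative there. *)
pose g t := - 2 * T ((x + t *: delta_mx 0 a) 0) ((x + t *: delta_mx 0 a) 0) (unitf b)
              / G (x + t *: delta_mx 0 a).
rewrite (@near_eq_derive _ _ _ _ g); last first.
  near=> t; rewrite /g derive1_phi; last by near: t; exact: volume_gt0_near.
  by field; apply: lt0r_neq0; near: t; exact: volume_gt0_near.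
have Gd := is_derive_volume x a.
have G0 : G (x + 0 *: delta_mx 0 a) != 0 by rewrite scale0r addr0 lt0r_neq0.
have nd : is_derive (0 : R) 1 (fun t =>
   - 2 * T ((x + t *: delta_mx 0 a) 0) ((x + t *: delta_mx 0 a) 0) (unitf b))
   (- 4 * T (x 0) (unitf a) (unitf b)).
  rewrite (_ : (fun t => _) = fun t => - 2 * T (x 0) (x 0) (unitf b)
    + (- 4 * T (x 0) (unitf a) (unitf b)) * t
    + (- 2 * T (unitf a) (unitf a) (unitf b)) * t ^+ 2 + 0 * t ^+ 3).
    exact: is_derive_cubic.
  apply: funext => t; rewrite row_shift delta_unitf.
  rewrite !(trilinPl, trilinPm).
  have -> : T (unitf a) (x 0) (unitf b) = T (x 0) (unitf a) (unitf b).
    exact: trilinC12.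
  by ring.
have [_ dE] := is_deriveM nd
  (is_deriveV (f := fun t => G (x + t *: delta_mx 0 a)) (x := 0) G0 Gd).
rewrite [LHS]dE scale0r addr0 /GRing.scale /=.
by field; rewrite lt0r_neq0.
Unshelve. all: by end_near. Qed.

Lemma K_hatCE : K_hatC D = fun Y => (phi (re_row Y))%:C.
Proof.
apply: funext => Y; rewrite /K_hatC /K_hat /kappa /volume.
by have -> : (re_row Y) 0 = fun a => complex.Re (Y 0 a)
  by apply: funext => a; rewrite mxE.
Qed.

End Kahler.
End Potentials.

(** * The metric, W and the F-terms in real and imaginary parts *)

Section RealForms.
Context {R : realType} {h : nat} (D : mirror_data R h).
Local Open Scope complex_scope.
Local Notation T := (@trilin R h D R).
Local Notation G x := (volume D x).

Lemma wirtinger_K_hatC a Z (x := re_row Z) : 0 < G x ->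
  wirtinger a (K_hatC D) Z = (- (2 * T (x 0) (x 0) (unitf a) / G x))%:C.
Proof.
move=> G_gt0; rewrite K_hatCE.
have [-> _] := wirtinger_re_row (fun x => - ln (G x)) a Z.
rewrite derive1_phi //; congr real_complex_def.
by field; rewrite lt0r_neq0.
Qed.

(** Closed form of the Kähler metric; the entries are real because K depends on the real parts
    only. *)
Definition re_metric (x : 'rV[R]_h) : 'M[R]_h :=
  \matrix_(a, b) (- 2 * T (x 0) (unitf a) (unitf b) / G x
    + 4 * T (x 0) (x 0) (unitf a) * T (x 0) (x 0) (unitf b) / G x ^+ 2).

Lemma kahler_metricE Z : 0 < G (re_row Z) ->
  kahler_metric D Z = map_mx (real_complex R) (re_metric (re_row Z)).
Proof.
move=> G_gt0; apply/matrixP => a b; rewrite !mxE.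
pose dphi x := derive1 (fun t => - ln (G (x + t *: delta_mx 0 b))) 0 / 2.
(* The first derivative again factors through the real parts, at every point, so [wirtinger_re_row]
   applies a second time. *)
have -> : wirtinger_bar b (K_hatC D) = fun Y => (dphi (re_row Y))%:C.
  apply: funext => Y; rewrite K_hatCE.
  by have [_ ->] := wirtinger_re_row (fun x => - ln (G x)) b Y.
have [-> _] := wirtinger_re_row dphi a Z.
rewrite /dphi derive1_dphi //; congr real_complex_def.
by field; rewrite lt0r_neq0.
Qed.

Lemma mul_re_metric (x v : 'rV[R]_h) b :
  (v *m re_metric x) 0 b = - 2 * T (x 0) (v 0) (unitf b) / G x
    + 4 * T (x 0) (x 0) (v 0) * T (x 0) (x 0) (unitf b) / G x ^+ 2.
Proof.
rewrite (trilinC23 D (x 0) (v 0)) !(trilin_unitf D _ _ (v 0)) mxE.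
under eq_bigr do rewrite mxE (trilinC23 D (x 0) (unitf _)).
move: (T (x 0) (x 0) (unitf b)) (G x) => tb g.
rewrite !(mulr_sumr, mulr_suml) -big_split; apply: eq_bigr => a _ /=; ring.
Qed.

Lemma c_tildeE : c_tilde D = Complex 0 (- k_const D / 2).
Proof.
have : complex.Re (c_tilde D) = 0.
  rewrite /c_tilde -complexiE -(rmorph_int (real_complex R)) -fmorphV.
  rewrite -!mulrA -!rmorphM /=.
  by ring.
rewrite /k_const; case: (c_tilde D) => x y /= ->.
by congr Complex; field.
Qed.

Lemma trilin_unitfc (x y : 'I_h -> R[i]) a :
  let xr := fun b => complex.Re (x b) in let xi := fun b => complex.Im (x b) in
  let yr := fun b => complex.Re (y b) in let yi := fun b => complex.Im (y b) in
  trilin D x y (unitf a) =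
  Complex (T xr yr (unitf a) - T xi yi (unitf a))
          (T xr yi (unitf a) + T xi yr (unitf a)).
Proof.
move=> xr xi yr yi.
have -> : unitf a = (fun b => (unitf a b)%:C) :> ('I_h -> R[i]).
  by apply: funext => b; rewrite rmorph_nat.
rewrite trilinC23 trilinC12 trilin_realc -/xr -/xi -/yr -/yi.
by rewrite !(trilinC12 D (unitf a)) !(trilinC23 D _ (unitf a)).
Qed.

Lemma complex_natV k : (k%:R : R[i])^-1 = ((k%:R : R)^-1)%:C.
Proof. by rewrite fmorphV rmorph_nat. Qed.

Section Fluxes.
Context (w : R) (n m : 'I_h.+1 -> int) (Z : 'rV[R[i]]_h).
Local Notation z := (fun a => complex.Re (Z 0 a)).
Local Notation y := (fun a => complex.Im (Z 0 a)).
Local Notation m0 := ((m ord0)%:~R : R).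
Local Notation mv := (fun a => (flux_tail m a)%:~R).
Local Notation n' := (n_prime D n m).

Lemma re_rowE : re_row Z 0 = z.
Proof. by apply: funext => a; rewrite mxE. Qed.

Lemma W_hatE : W_hat D w n m Z =
  Complex
    (w * (n0_prime D n m - \sum_a n' a * y a - (T mv z z - T mv y y) / 2
          - m0 / 6 * (3 * T z z y - T y y y)))
    (w * (m0 * k_const D / 2 + \sum_a n' a * z a - T mv z y
          + m0 / 6 * (T z z z - 3 * T y y z))).
Proof.
have -> : W_hat D w n m Z =
    w%:C * ((n0_prime D n m)%:C - m0%:C * c_tilde D
      + 'i * \sum_a (n' a)%:C * Z 0 a
      - 2^-1 * trilin D (fun a => real_complex R (mv a)) (Z 0) (Z 0)
      + 'i * m0%:C / 6 * trilin D (Z 0) (Z 0) (Z 0)).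
  rewrite /W_hat rmorph_int.
  congr (_ * (_ - _ * trilin _ _ _ _ + _)).
  by apply: funext => a; rewrite rmorph_int.
rewrite c_tildeE -complexiE trilin_realc trilin_complex !complex_natV.
have -> : \sum_a (n' a)%:C * Z 0 a
    = Complex (\sum_a n' a * z a) (\sum_a n' a * y a).
  have rmulC (c : R) (u : R[i]) :
      c%:C * u = Complex (c * complex.Re u) (c * complex.Im u).
    by case: u => p q; congr Complex; rewrite mul0r ?subr0 ?addr0.
  rewrite [LHS]complexE raddf_sum (raddf_sum (@complex.Im R)) /=.
  under eq_bigr => a _ do rewrite rmulC /=.
  under [X in _ + _ * X%:C]eq_bigr => a _ do rewrite rmulC /=.
  by congr Complex; rewrite /=; ring.
rewrite (trilinC23 D mv y z) (trilinC12 D y z z) (trilinC23 D z y z).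
rewrite (trilinC12 D z y y) (trilinC23 D y z y).
apply/eqP; rewrite eq_complex /=; apply/andP; split; apply/eqP; by field.
Qed.

(** Since the derivative of K is real, Re F_a sees only Re W and Im F_a only Im W. The fluxes n'_a
    enter Re F_a solely through Re W. *)
Lemma F_termE a : 0 < G (re_row Z) -> F_term D w n m a Z =
  Complex
    (w * (- T mv z (unitf a) - m0 * T z y (unitf a))
      - 2 * T z z (unitf a) / G (re_row Z) * complex.Re (W_hat D w n m Z))
    (w * (n' a - T mv y (unitf a) + m0 / 2 * (T z z (unitf a) - T y y (unitf a)))
      - 2 * T z z (unitf a) / G (re_row Z) * complex.Im (W_hat D w n m Z)).
Proof.
move=> G_gt0; rewrite /F_term wirtinger_W_hat wirtinger_K_hatC // re_rowE.
rewrite !trilin_unitfc.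
have -> : (fun b => complex.Re ((flux_tail m b)%:~R : R[i])) = mv.
  by apply: funext => b; rewrite -(rmorph_int (real_complex R)).
have -> : (fun b => complex.Im ((flux_tail m b)%:~R : R[i])) = fun=> 0.
  by apply: funext => b; rewrite -(rmorph_int (real_complex R)).
rewrite !trilin0l -(rmorph_int (real_complex R)) complex_natV -complexiE.
case: (W_hat D w n m Z) => p q; rewrite (trilinC12 D y z).
apply/eqP; rewrite eq_complex /=; apply/andP; split; apply/eqP;
  by field; rewrite lt0r_neq0.
Qed.
Lemma W_hat_const : m ord0 = 0 -> mv = (fun=> 0 : R) ->
  (forall a, n' a = 0) -> W_hat D w n m Z = Complex (w * n0_prime D n m) 0.
Proof.
move=> m0_eq0 mv0 n'0; rewrite W_hatE m0_eq0 mv0 !trilin0l.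
rewrite !big1 => [|a _|a _]; rewrite ?n'0 ?mul0r //.
by congr Complex; ring.
Qed.

End Fluxes.

(** * Consequences of the F-term equations at a solution *)

Section FlatPoint.
Context (w : R) (n m : 'I_h.+1 -> int) (Z : 'rV[R[i]]_h).
Local Notation z := (fun a => complex.Re (Z 0 a)).
Local Notation y := (fun a => complex.Im (Z 0 a)).
Local Notation m0 := ((m ord0)%:~R : R).
Local Notation mv := (fun a => (flux_tail m a)%:~R).
Local Notation n' := (n_prime D n m).

Hypotheses (G_gt0 : 0 < G (re_row Z)) (kappa_gt0 : 0 < T z z z).
Hypothesis metric_unit : kahler_metric D Z \in unitmx.
Hypothesis F_flat : forall a, F_term D w n m a Z = 0.
Local Notation g := (G (re_row Z)).
Local Notation W := (W_hat D w n m Z).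

(** The hypothesis says that v is annihilated by the metric. Invertibility over the complex numbers
    descends to the real matrix, so v = v M M^-1 = 0. *)
Lemma re_metric_nondeg (v : 'I_h -> R) :
  (forall b, - 2 * T z v (unitf b) / g
     + 4 * T z z v * T z z (unitf b) / g ^+ 2 = 0) -> v = fun=> 0.
Proof.
move=> v_null; have M_unit : re_metric (re_row Z) \in unitmx.
  by move: metric_unit; rewrite kahler_metricE // map_unitmx.
pose rv : 'rV[R]_h := \row_a v a.
have rvE : rv 0 = v by apply: funext => a; rewrite mxE.
suff rv0 : rv = 0 by rewrite -rvE rv0; apply: funext => a; rewrite mxE.
rewrite -[rv](mulmxK M_unit) [X in X *m _](_ : _ = 0) ?mul0mx //.
by apply/rowP => b; rewrite mul_re_metric re_rowE rvE v_null mxE.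
Qed.

Lemma volumeE : g = 4 / 3 * T z z z + k_const D.
Proof. by rewrite /volume re_rowE. Qed.

(* At the excluded value, z is a null vector of the metric. *)
Lemma k_const_neq : 2 / 3 * T z z z - k_const D != 0.
Proof.
apply/eqP => k_eq; have gE : g = 2 * T z z z by rewrite volumeE; lra.
have z0 : z = fun=> 0.
  apply: re_metric_nondeg => b; rewrite gE.
  by field; rewrite lt0r_neq0.
by move: kappa_gt0; rewrite {1}z0 trilin0l ltxx.
Qed.

(* Contracting the imaginary part of the F-terms with z^a eliminates n'_a. *)
Lemma Im_W : complex.Im W = w * m0 * g / 2.
Proof.
have F_im : \sum_a z a * complex.Im (F_term D w n m a Z) = 0.
  by rewrite big1 // => a _; rewrite F_flat mulr0.
have : w * (\sum_a n' a * z a - T mv y z + m0 / 2 * (T z z z - T y y z))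
       - 2 * T z z z / g * complex.Im W = 0.
  rewrite -[RHS]F_im; under [in RHS]eq_bigr => a _ do rewrite F_termE //=.
  rewrite (trilin_unitf D mv y z) (trilin_unitf D z z z) (trilin_unitf D y y z).
  move: (complex.Im W) g => p q.
  rewrite !(mulr_sumr, mulr_suml, =^~ sumrN, =^~ big_split) /=.
  by apply: eq_bigr => a _; ring.
have := W_hatE w n m Z; case: W => p q [_ ->] /=; move: k_const_neq.
have -> : k_const D = g - 4 / 3 * T z z z by rewrite volumeE addrC addKr.
have g_neq0 : g != 0 by rewrite lt0r_neq0.
(* With k expressed through G, the nonzero factor 2/3 kappa - k is 2 kappa - G. Multiplying the
   contracted equation by -G gives this factor times Im W - w m^0 G / 2. *)
rewrite (trilinC23 D mv y z) => k_neq F_im0; apply: (mulfI k_neq).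
apply: subr0_eq; apply: etrans _ (etrans (congr1 ( *%R (- g)) F_im0) (mulr0 _)).
by field.
Qed.

Section NoCubicFlux.
Hypotheses (w_neq0 : w != 0) (m0_eq0 : m ord0 = 0).

(* The real parts of the F-terms say that m - lambda z is a null vector of
   T z, hence of the metric. *)
Lemma flux_proportional : exists2 lambda : R,
  mv = (fun a => lambda * z a) & complex.Re W = - (w * lambda * g / 2).
Proof.
have g_neq0 : g != 0 by rewrite lt0r_neq0.
pose lambda := - (2 * complex.Re W / (w * g)).
exists lambda; last by rewrite /lambda; field; rewrite g_neq0.
pose v a := mv a + (- lambda) * z a.
have Tv b : T z v (unitf b) = 0.
  have : complex.Re (F_term D w n m b Z) = 0 by rewrite F_flat.
  rewrite F_termE //= m0_eq0 mul0r subr0 => F_re.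
  rewrite /v trilinPm (trilinC12 D z mv); apply: (mulfI w_neq0).
  rewrite mulr0 -[RHS]oppr0 -F_re /lambda.
  by field; rewrite g_neq0.
have v0 : v = fun=> 0.
  (* The first term of the metric vanishes on v by [Tv]; the second contains d_abc z^a z^b v^c,
     which is [Tv] contracted with z. *)
  apply: re_metric_nondeg => b; rewrite Tv (trilinC23 D z z) trilin_unitf.
  by rewrite big1 ?mulr0 ?mul0r ?addr0 // => a _; rewrite Tv mulr0.
apply: funext => a; have := congr1 (fun f : 'I_h -> R => f a) v0.
by rewrite /v mulNr => /subr0_eq.
Qed.

(** This serves to exclude lambda = 0. Without m-fluxes, contracting m = lambda z with the form
    gives lambda kappa = 0, hence W = 0 at Z; then Im F_a = 0 reduces to w n'_a = 0, and W is a
    constant, zero at Z and so everywhere. *)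
Lemma W_hat_trivial : mv = (fun=> 0 : R) -> forall Y, W_hat D w n m Y = 0.
Proof.
move=> mv0; have [lambda mvE ReW] := flux_proportional.
have lambda0 : lambda = 0.
  have : T mv z z = 0 by rewrite mv0 trilin0l.
  rewrite mvE trilinZl => /eqP.
  by rewrite mulf_eq0 (gt_eqF kappa_gt0) orbF => /eqP.
have W0 : W = 0.
  have := Im_W; rewrite m0_eq0 mulr0 !mul0r; move: ReW; rewrite lambda0.
  by rewrite mulr0 !mul0r oppr0; case: W => p q /= -> ->.
have n'0 a : n' a = 0.
  have : complex.Im (F_term D w n m a Z) = 0 by rewrite F_flat.
  rewrite F_termE //= W0 mv0 trilin0l m0_eq0 /= mulr0 !mul0r !subr0 addr0.
  by move/eqP; rewrite mulf_eq0 (negPf w_neq0) => /eqP.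
by move=> Y; rewrite -[RHS]W0 !W_hat_const.
Qed.

End NoCubicFlux.
End FlatPoint.

End RealForms.

(** * Closed forms of the prefactors and assembly of the two cases *)

Lemma half_volume_factors (R : realType) (kappa k g : R) :
  0 < kappa -> 0 < g -> g = 4 / 3 * kappa + k ->
  let s := 1 + 3 * k / (4 * kappa) in
  g / 2 = 2 / 3 * s * kappa
  /\ expR (- ln g / 2) * (g / 2) = Num.sqrt (3^-1 * s) * kappa `^ (1 / 2).
Proof.
move=> kappa_gt0 g_gt0 gE s.
have gs : g = 4 / 3 * (s * kappa).
  by rewrite gE /s; field; rewrite lt0r_neq0.
have s_gt0 : 0 < s.
  by move: g_gt0; rewrite gs pmulr_rgt0 ?pmulr_lgt0 //; lra.
split; first by rewrite gs; field.
(* Here exp(K/2) = G^(-1/2), so the left side is sqrt(G) / 2; the right side is sqrt(s kappa / 3) =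
   sqrt(G / 4). *)
have -> : expR (- ln g / 2) = (Num.sqrt g)^-1.
  rewrite -powR12_sqrt ?ltW // -powRN /powR gt_eqF //.
  by congr expR; field.
rewrite div1r powR12_sqrt ?ltW // -sqrtrM; last by rewrite mulr_ge0 ?ltW //; lra.
have -> : 3^-1 * s * kappa = g * 2^-1 ^+ 2 by rewrite gs; field.
rewrite sqrtrM ?ltW // sqrtr_sqr ger0_norm; last by lra.
rewrite -{2}(sqr_sqrtr (ltW g_gt0)).
by field; rewrite gt_eqF // sqrtr_gt0.
Qed.


Theorem theorem3p2 (R : realType) (h : nat) (D : mirror_data R h)
    (w : R) (n m : 'I_h.+1 -> int) (Z : 'rV[R[i]]_h)
    (w_neq0 : w != 0)
    (W_nontrivial : ~ (forall Y : 'rV[R[i]]_h, W_hat D w n m Y = 0))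
    (kappa_pos : 0 < kappa D Z)
    (K_defined : - (3 * k_const D / 4) < kappa D Z)
    (metric_nondeg : kahler_metric D Z \in unitmx)
    (F_flat : forall a : 'I_h, F_term D w n m a Z = 0) :
  (m ord0 != 0 ->
     `|complex.Im (W_hat D w n m Z)|
       = 2 * `|w| / 3 * (1 + 3 * k_const D / (4 * kappa D Z))
         * `|(m ord0)%:~R| * kappa D Z
     /\
     `|complex.Im (U_hat D w n m Z)|
       = `|w| * Num.sqrt (3^-1 * (1 + 3 * k_const D / (4 * kappa D Z)))
         * `|(m ord0)%:~R| * kappa D Z `^ (1 / 2))
  /\
  (m ord0 = 0 ->
     [/\ kappa_flux D m != 0,
         `|complex.Re (W_hat D w n m Z)|
           = 2 * `|w| / 3 * (1 + 3 * k_const D / (4 * kappa D Z))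
             * `|(kappa_flux D m)%:~R| `^ (1 / 3) * kappa D Z `^ (2 / 3)
       & `|complex.Re (U_hat D w n m Z)|
           = `|w| * Num.sqrt (3^-1 * (1 + 3 * k_const D / (4 * kappa D Z)))
             * `|(kappa_flux D m)%:~R| `^ (1 / 3) * kappa D Z `^ (1 / 6)]).
Proof.
pose K := kappa D Z; pose g := 4 / 3 * K + k_const D.
have g_gt0 : 0 < g by move: K_defined; rewrite /g -/K; lra.
have volE : volume D (re_row Z) = g by rewrite volumeE.
have [half_g expg] := half_volume_factors kappa_pos g_gt0 erefl.
have vol_gt0 : 0 < volume D (re_row Z) by rewrite volE.
have Im_W := Im_W vol_gt0 kappa_pos metric_nondeg F_flat.
have expK_ge0 := expR_ge0 (K_hat D Z / 2).
split=> [m0_neq0|m0_eq0].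
  have W_im : `|complex.Im (W_hat D w n m Z)| = `|w| * `|(m ord0)%:~R| * (g / 2).
    rewrite Im_W volE -mulrA normrM (normrM w).
    by rewrite (ger0_norm (_ : 0 <= g / 2)) // divr_ge0 // ltW.
  have U_im : complex.Im (U_hat D w n m Z)
      = expR (K_hat D Z / 2) * complex.Im (W_hat D w n m Z).
    by rewrite /U_hat; case: (W_hat D w n m Z) => p q /=; rewrite mul0r addr0.
  split; first by rewrite W_im half_g; ring.
  rewrite U_im normrM (ger0_norm expK_ge0) W_im mulrCA expg.
  by rewrite !mulrA; ring.
have [lambda mE W_re] :=
  flux_proportional vol_gt0 metric_nondeg F_flat w_neq0 m0_eq0.
have fluxE : (kappa_flux D m)%:~R = lambda ^+ 3 * K.
  rewrite /kappa_flux (rmorph_trilin D intr) /comp mE trilinZl trilinZr.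
  by rewrite trilinC12 trilinZl -[trilin _ _ _ _]/K; ring.
have lambda_neq0 : lambda != 0.
  apply/eqP => lambda0; apply: W_nontrivial.
  apply: (W_hat_trivial vol_gt0 kappa_pos metric_nondeg F_flat w_neq0 m0_eq0).
  by rewrite mE lambda0; apply: funext => a; rewrite mul0r.
(* Since lambda may be negative, the absolute value is taken before the real cube root. This trades
   the unknown |lambda| for the flux invariant. *)
have cbrt : `|(kappa_flux D m)%:~R : R| `^ (1 / 3) = `|lambda| * K `^ (1 / 3).
  rewrite fluxE normrM normrX (gtr0_norm kappa_pos).
  rewrite powRM ?exprn_ge0 ?(ltW kappa_pos) //.
  by rewrite -powR_mulrn // -powRrM div1r divff ?pnatr_eq0 // powRr1.
have powK (p q r : R) : p + q = r -> K `^ p * K `^ q = K `^ r.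
  by move=> <-; rewrite powRD // (gt_eqF kappa_pos) implybT.
have W_re_norm : `|complex.Re (W_hat D w n m Z)| = `|w| * `|lambda| * (g / 2).
  rewrite W_re volE normrN -mulrA normrM (normrM w).
  by rewrite (ger0_norm (_ : 0 <= g / 2)) // divr_ge0 // ltW.
have U_re : complex.Re (U_hat D w n m Z)
    = expR (K_hat D Z / 2) * complex.Re (W_hat D w n m Z).
  by rewrite /U_hat; case: (W_hat D w n m Z) => p q /=; rewrite mul0r subr0.
split.
- rewrite -(intr_eq0 R) fluxE mulf_neq0 ?expf_neq0 //.
  by rewrite gt_eqF.
(* One factor kappa^(1/3) is split off to join |lambda| in |kappa(m)|^(1/3); the exponent 2/3 is
   what remains of kappa. For U the same splitting of kappa^(1/2) leaves 1/6. *)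
- have K1 : K `^ (1 / 3) * K `^ (2 / 3) = K.
    by rewrite (powK _ _ 1) ?powRr1 ?ltW //; field.
  rewrite cbrt W_re_norm half_g -/K; move: (1 + _ / _) => s.
  by rewrite -[X in _ * (_ * X) = _]K1; ring.
- have K1 : K `^ (1 / 3) * K `^ (1 / 6) = K `^ (1 / 2) by apply: powK; field.
  rewrite U_re normrM (ger0_norm expK_ge0) W_re_norm mulrCA expg -/K -K1 cbrt.
  by ring.
Qed.
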